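(* Let $(X,T)$ be a linearly recurrent subshift. Then the set of non-periodic subshift factors of $(X,T)$ is finite up to isomorphism; that is, there are finitely many subshifts such that every non-periodic subshift which is a factor of $(X,T)$ is isomorphic to one of them.
   Context: An alphabet is a finite set $A$; $A^{\mathbb Z}$ carries the product topology (discrete on $A$) and $T$ is the shift $(x_n)_n\mapsto (x_{n+1})_n$. A subshift on $A$ is a pair $(X,T)$ with $X\subset A^{\mathbb Z}$ closed and $T(X)=X$. A dynamical system $(X,S)$ is a compact metric space with a homeomorphism $S$; it is minimal if $X$ and $\emptyset$ are the only $S$-invariant closed subsets. A minimal system is periodic if its space is finite, and non-periodic otherwise (factors of minimal systems are minimal). $(Y,S')$ is a factor of $(X,S)$ if there is a continuous onto map $\phi:X\to Y$ with $\phi S=S'\phi$ (a factor map); $\phi$ is an isomorphism if it is also one-to-one. A subshift factor of $(X,T)$ is a factor which is a subshift on some finite alphabet (with the shift map, also denoted $T$). Linearly recurrent: let $x\in A^{\mathbb Z}$ and let $L(x)$ be the set of finite words occurring in $x$. For a non-empty $u\in L(x)$, a return word to $u$ of $x$ is a word $w$ such that $wu\in L(x)$, $u$ is a prefix of $wu$, and $u$ has exactly two occurrences in $wu$. The sequence $x$ is uniformly recurrent if for each word of $L(x)$ the differences between successive occurrences in $x$ are bounded. $x$ is linearly recurrent (LR) with constant $K\in\mathbb N$ if it is uniformly recurrent and $|w|\le K|u|$ for every non-empty $u\in L(x)$ and every return word $w$ to $u$ of $x$. A subshift is linearly recurrent (with constant $K$) if it is minimal and contains an LR sequence (with constant $K$).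 *)

(* Defs.v *)
From HB Require Import structures.
From mathcomp Require Import all_boot all_order all_algebra.
From mathcomp Require Import all_classical.
From mathcomp Require Import topology.

Set Implicit Arguments.
Unset Strict Implicit.
Unset Printing Implicit Defensive.

Import Order.TTheory GRing.Theory Num.Theory.

Local Open Scope classical_set_scope.
Local Open Scope ring_scope.

(* [discrete_topology A] is [A] carrying the discrete topology, so that this
   is A^Z with the product topology. *)
Definition fullshift (A : finType) : topologicalType :=
  prod_topology (fun _ : int => discrete_topology A).

Definition shift (A : finType) (x : fullshift A) : fullshift A :=
  fun n : int => x (n + 1).

Record subshift : Type := Subshift {
  alphabet : finType;
  points :> set (fullshift alphabet);
  points_closed : closed points;
  points_shift : @shift alphabet @` points = points
}.

Arguments points : clear implicits.

Definition minimal (X : subshift) : Prop :=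
  forall F : set (fullshift (alphabet X)),
    F `<=` X -> closed F -> @shift (alphabet X) @` F = F ->
    F = set0 \/ F = X.

Definition occurs_at (A : finType) (x : fullshift A) (u : seq A) (i : int) :
    Prop :=
  mkseq (fun k : nat => x (i + k%:Z)) (size u) = u.

Definition language (A : finType) (x : fullshift A) : set (seq A) :=
  [set u | exists i : int, occurs_at x u i].

(* Only meant for non-empty [u]: then [prefix u (drop j s)] forces
   [j + size u <= size s]. *)
Definition occurrences (A : finType) (u s : seq A) : nat :=
  count (fun j => prefix u (drop j s)) (iota 0 (size s).+1).

Definition return_word (A : finType) (x : fullshift A) (u w : seq A) : Prop :=
  [/\ language x (w ++ u), prefix u (w ++ u) & occurrences u (w ++ u) = 2%N].

(* Bounded gaps in both directions: each occurrence is required to have a next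
   and a previous one, which excludes e.g. ...0001000... *)
Definition uniformly_recurrent (A : finType) (x : fullshift A) : Prop :=
  forall u : seq A, language x u ->
  exists M : nat, forall i : int, occurs_at x u i ->
    (exists2 j : int, i < j <= i + M%:Z & occurs_at x u j) /\
    (exists2 j : int, i - M%:Z <= j < i & occurs_at x u j).

Definition lr_sequence (K : nat) (A : finType) (x : fullshift A) : Prop :=
  uniformly_recurrent x /\
  forall u w : seq A, u != [::] -> language x u -> return_word x u w ->
    (size w <= K * size u)%N.

Definition linearly_recurrent_with (K : nat) (X : subshift) : Prop :=
  minimal X /\ exists2 x, points X x & lr_sequence K x.

Definition linearly_recurrent (X : subshift) : Prop :=
  exists K : nat, linearly_recurrent_with K X.

(* A map between subshifts is given by a map of the ambient full shifts, of
   which only the restriction to [X] matters. *)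
Definition factor_map (X Y : subshift)
    (phi : fullshift (alphabet X) -> fullshift (alphabet Y)) : Prop :=
  [/\ {within X, continuous phi},
      phi @` X = Y &
      forall x, points X x -> phi (shift x) = shift (phi x)].

Definition factor_of (Y X : subshift) : Prop :=
  exists phi, @factor_map X Y phi.

Definition isomorphic (X Y : subshift) : Prop :=
  exists2 phi, @factor_map X Y phi & set_inj X phi.

(* Used for minimal subshifts only; factors of minimal ones are minimal. *)
Definition non_periodic (X : subshift) : Prop := infinite_set X.

(* Main.v *)
(* Only finitely many equivalence relations on X are of the form
   phi x = phi x' with phi a factor map onto a non-periodic subshift. Indeed,
   given finitely many such maps, choose a scale n much larger than all their
   radii. Linear recurrence gives a constant C such that all words of X of
   length about n occur in a window of length C n of a fixed point x0, and such
   that distinct occurrences of a word of length n in phi x0 are n / (2C) apart.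
   Cut the window into boxes of side a small fraction of n and record, for each
   phi, which pairs of boxes contain occurrences of a same word of length n in
   phi x0. The number of possible records depends on C only. If f and g have
   the same record and f x = f x', then around each position g x and g x' agree
   up to a small offset; separation of occurrences makes the offset constant, so
   that g x' is a translate of g x by some c. By minimality every point of X
   then has a partner in its f-fibre with offset c; iterating gives offsets c,
   2c, 3c, etc., all of which must be small, so c = 0. Hence f and g have the
   same fibres and their images are isomorphic. *)
Require Import Defs.
From mathcomp Require Import all_boot all_order all_algebra all_classical.
From mathcomp Require Import topology zify.

Set Implicit Arguments.
Unset Strict Implicit.
Unset Printing Implicit Defensive.

Import Order.TTheory GRing.Theory Num.Theory.

Local Open Scope classical_set_scope.
Local Open Scope ring_scope.

(** * Agreement on windows and the topology of the full shift *)

Definition agree (T : Type) (x : int -> T) (p : int) (y : int -> T) (q n : int)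
    : Prop :=
  forall k : int, 0 <= k < n -> x (p + k) = y (q + k).

Definition agree_upto (T : Type) (M : nat) (x y : int -> T) : Prop :=
  forall k : int, (`|k| <= M)%N -> x k = y k.

Lemma nbhs_agree_upto (A : finType) (x : fullshift A) (M : nat) :
  nbhs x [set y : fullshift A | agree_upto M x y].
Proof.
have coord (k : int) : nbhs x [set y : fullshift A | x k = y k].
  have h : nbhs x (proj k @^-1` [set (x k : discrete_topology A)]).
    by apply: proj_continuous; exact: discrete_set1.
  by apply: filterS h => y /esym.
elim: M => [|M IH].
  apply: filterS (coord 0) => y /= h k hk.
  by have -> : k = 0 by lia.
apply: filterS (filterI IH (filterI (coord M.+1%:Z) (coord (- M.+1%:Z)))).
move=> y /= [h [h1 h2]] k hk.
have [hM|hM] := leqP `|k| M; first exact: h.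
by have [->|->] : k = M.+1%:Z \/ k = - M.+1%:Z by lia.
Qed.

(** The cylinders around [x] generate a filter that converges to [x], because convergence in a
    product is checked coordinate by coordinate. *)
Lemma nbhs_sub_agree_upto (A : finType) (x : fullshift A) (U : set (fullshift A)) :
  nbhs x U -> exists M, [set y : fullshift A | agree_upto M x y] `<=` U.
Proof.
pose B := fun M : nat => [set y : fullshift A | agree_upto M x y].
have FB : Filter (filter_from setT B).
  apply: filter_from_filter; first by exists 0%N.
  move=> i j _ _; exists (maxn i j) => // y h; split=> k hk; apply: h; lia.
suff cvgB : filter_from setT B --> x.
  by move=> /cvgB[M _ MU]; exists M.
apply/cvg_sup => k.
apply/cvg_image; first by apply/seteqP; split=> // a _; exists (fun=> a).
move=> V /nbhs_singleton Vxk; exists [set y : fullshift A | V (y k)].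
  by exists `|k|%N => // y /= <-.
by apply/seteqP; split=> [_ [y Vy <-] //|a Va]; exists (fun=> a).
Qed.

Lemma closed_agree_upto (A : finType) (S : set (fullshift A)) :
  (forall x, (forall M, exists2 y, S y & agree_upto M x y) -> S x) -> closed S.
Proof.
move=> h x clx; apply: h => M.
by have [y [Sy xy]] := clx _ (nbhs_agree_upto x M); exists y.
Qed.

Lemma closed_mem (A : finType) (S : set (fullshift A)) x : closed S ->
  (forall M, exists2 y, S y & agree_upto M x y) -> S x.
Proof.
move=> clS h; apply: clS => U /nbhs_sub_agree_upto[M MU].
by have [y Sy xy] := h M; exists y; split=> //; apply: MU.
Qed.

(** Tychonoff compactness in the form of a cluster point, used below in place of convergent
    subsequences. *)
Lemma seq_cluster (A : finType) (S : set (fullshift A))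
    (u : nat -> fullshift A) :
  closed S -> (forall M, S (u M)) ->
  exists2 x, S x & forall M, exists2 N, (M <= N)%N & agree_upto M x (u N).
Proof.
move=> clS Su.
have cpt : compact [set: fullshift A].
  have cptA : compact [set: discrete_topology A].
    by apply: finite_compact; exact: (@finite_finset A).
  have := @tychonoff int (fun=> discrete_topology A) (fun=> setT) (fun=> cptA).
  by congr compact; apply/seteqP; split.
have [] := @subclosed_compact _ _ _ clS cpt (@subsetT _ _) (u @ \oo) _.
  by exists 0%N => // n _; exact: Su.
move=> x [Sx clx]; exists x => // M.
have [] := clx (u @` [set N | (M <= N)%N]) _ _ (nbhs_agree_upto x M).
  by exists M => // N MN; exists N.
by move=> _ [[N MN <-] xN]; exists N.
Qed.

Section Agree.
Variable T : Type.
Implicit Types x y z : int -> T.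

Lemma agree_sym x p y q n : agree x p y q n -> agree y q x p n.
Proof. by move=> h k hk; rewrite h. Qed.

Lemma agree_trans y q x p z r n :
  agree x p y q n -> agree y q z r n -> agree x p z r n.
Proof. by move=> h1 h2 k hk; rewrite h1 ?h2. Qed.

Lemma agree_sub x p y q n p' q' n' : agree x p y q n ->
  p <= p' -> p' + n' <= p + n -> q' - p' = q - p -> agree x p' y q' n'.
Proof.
move=> h h1 h2 h3 k hk; have := h (p' - p + k).
rewrite (_ : p + _ = p' + k); last lia.
by rewrite (_ : q + _ = q' + k); [apply|]; lia.
Qed.

Lemma agree_at x p y q n s t : agree x p y q n ->
  p <= s < p + n -> t - s = q - p -> x s = y t.
Proof.
move=> h h1 h2; have := h (s - p).
rewrite (_ : p + _ = s); last lia.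
by rewrite (_ : q + _ = t); [apply|]; lia.
Qed.

End Agree.

(** * Integer powers of the shift and minimality *)

Definition shiftz (A : finType) (a : int) (x : fullshift A) : fullshift A :=
  fun n => x (n + a).

Section Shiftz.
Variable A : finType.
Implicit Type x : fullshift A.

Lemma shiftz0 x : shiftz 0 x = x.
Proof. by apply/funext => n; rewrite /shiftz addr0. Qed.

Lemma shiftzD a b x : shiftz a (shiftz b x) = shiftz (a + b) x.
Proof. by apply/funext => n; rewrite /shiftz addrA. Qed.

Lemma shift_shiftz x : shift x = shiftz 1 x.
Proof. by []. Qed.

Lemma shiftz_stable (S : set (fullshift A)) a x :
  (forall y, S y -> S (shiftz 1 y)) -> (forall y, S y -> S (shiftz (-1) y)) ->
  S x -> S (shiftz a x).
Proof.
move=> S1 SN1 Sx; case: a => n; elim: n => [|n IH].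
- by rewrite shiftz0.
- by rewrite (_ : Posz n.+1 = 1 + n%:Z) -?shiftzD; [exact: S1 | lia].
- exact: SN1.
- by rewrite (_ : Negz n.+1 = -1 + Negz n) -?shiftzD; [exact: SN1 | lia].
Qed.

End Shiftz.

Lemma subshift_shiftz (X : subshift) a x : points X x -> points X (shiftz a x).
Proof.
apply: shiftz_stable => y Xy; first by rewrite -points_shift; exists y.
move: Xy; rewrite -{1}points_shift => -[z Xz <-].
by rewrite shift_shiftz shiftzD shiftz0.
Qed.

Lemma minimal_full (X : subshift) (F : set (fullshift (alphabet X))) z :
  minimal X -> F `<=` X ->
  (forall x, (forall M, exists2 y, F y & agree_upto M x y) -> F x) ->
  (forall y, F y -> F (shiftz 1 y)) -> (forall y, F y -> F (shiftz (-1) y)) ->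
  F z -> X `<=` F.
Proof.
move=> minX FX clF F1 FN1 Fz.
have [||||<-//] := minX F; first by [].
- exact: closed_agree_upto.
- apply/seteqP; split=> [_ [y Fy <-]|y Fy]; first exact: F1.
  exists (shiftz (-1) y); first exact: FN1.
  by rewrite shift_shiftz shiftzD shiftz0.
- by move=> F0; rewrite F0 in Fz.
Qed.

(** The orbit closure of [x] is closed, shift-stable and non-empty, so minimality makes it all of
    [X]. *)
Lemma minimal_orbit_dense (X : subshift) x y M :
  minimal X -> points X x -> points X y ->
  exists a, agree_upto M y (shiftz a x).
Proof.
move=> minX Xx Xy.
pose F := [set y | points X y /\ forall M, exists a, agree_upto M y (shiftz a x)].
suff /(_ y Xy)[_] : X `<=` F by [].
apply: (@minimal_full X F x) => //.
- by move=> ? [].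
- move=> z h; split.
    by apply: closed_mem => [|N]; [exact: points_closed | have [w []] := h N; exists w].
  move=> N; have [w [_ /(_ N)[a wa]] zw] := h N.
  by exists a => k hk; rewrite zw ?wa.
- move=> z [Xz h]; split; first exact: subshift_shiftz.
  move=> N; have [a za] := h N.+1; exists (1 + a) => k hk.
  by rewrite -shiftzD [LHS]za //; lia.
- move=> z [Xz h]; split; first exact: subshift_shiftz.
  move=> N; have [a za] := h N.+1; exists (-1 + a) => k hk.
  by rewrite -shiftzD [LHS]za //; lia.
- by split=> // N; exists 0; rewrite shiftz0.
Qed.

(** * From return words to linear repetitivity *)

Definition word_at (A : finType) (x : fullshift A) (i : int) (m : nat) : seq A :=
  mkseq (fun k : nat => x (i + k%:Z)) m.

Lemma occurs_word_at (A : finType) (x : fullshift A) i j m :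
  occurs_at x (word_at x i m) j <-> agree x j x i m.
Proof.
rewrite /occurs_at size_mkseq; split=> [h k hk|h].
  have hk' : (`|k| < m)%N by lia.
  have := congr1 (nth (x 0) ^~ `|k|%N) h.
  by rewrite !nth_mkseq // (_ : `|k|%N%:Z = k); last lia.
apply: (@eq_from_nth _ (x 0)); first by rewrite !size_mkseq.
by move=> k; rewrite size_mkseq => hk; rewrite !nth_mkseq ?h //; lia.
Qed.

Lemma prefix_drop_word_at (A : finType) (x : fullshift A) i j m d :
  (j <= d)%N ->
  prefix (word_at x i m) (drop j (word_at x i (d + m))) <->
  occurs_at x (word_at x i m) (i + j%:Z).
Proof.
move=> jd; rewrite prefixE size_mkseq.
have -> : take m (drop j (word_at x i (d + m))) = word_at x (i + j%:Z) m.
  apply: (@eq_from_nth _ (x 0)).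
    by rewrite size_takel ?size_drop ?size_mkseq //; lia.
  move=> k; rewrite size_takel ?size_drop ?size_mkseq; last lia.
  move=> km; rewrite nth_take // nth_drop !nth_mkseq //; last lia.
  by congr x; lia.
by rewrite /occurs_at size_mkseq; split=> /eqP.
Qed.

(** Here [d] is a first return time: an occurrence strictly between [0] and [d] contradicts [hmin]
    and one beyond [d] does not fit, so exactly two are counted. *)
Lemma return_word_word_at (A : finType) (x : fullshift A) i m d :
  (0 < m)%N -> (0 < d)%N -> agree x (i + d%:Z) x i m ->
  (forall j, (0 < j < d)%N -> ~ agree x (i + j%:Z) x i m) ->
  return_word x (word_at x i m) (word_at x i d).
Proof.
move=> m0 d0 hd hmin.
have catE : word_at x i d ++ word_at x i m = word_at x i (d + m).
  apply: (@eq_from_nth _ (x 0)); first by rewrite size_cat !size_mkseq.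
  move=> k; rewrite size_cat !size_mkseq => hk.
  rewrite nth_cat size_mkseq; case: ifPn => kd; rewrite !nth_mkseq //; last lia.
  rewrite -(hd (k - d)%N) //; last lia.
  by congr x; lia.
rewrite /return_word catE; split.
- by exists i; rewrite /occurs_at size_mkseq.
- rewrite -[word_at x i (d + m)]drop0; apply/prefix_drop_word_at => //.
  by apply/occurs_word_at; rewrite addr0.
rewrite /occurrences size_mkseq.
rewrite (@eq_in_count _ _ (predU (pred1 0%N) (pred1 d))); last first.
  move=> j; rewrite mem_iota /= => hj.
  apply/idP/idP => [h|].
    have jd : (j <= d)%N.
      have := size_prefix h.
      by rewrite size_drop !size_mkseq; lia.
    move/prefix_drop_word_at : h => /(_ jd)/occurs_word_at h.
    have [//|j0] := eqVneq j 0%N; have [//|jnd] := eqVneq j d.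
    by case: (hmin j); [lia|].
  case/orP=> /eqP ->; apply/prefix_drop_word_at => //; apply/occurs_word_at => //.
  by rewrite addr0.
have := count_predUI (pred1 0%N) (pred1 d) (iota 0 (d + m).+1).
rewrite (@eq_count _ (predI _ _) pred0) => [|j /=]; last lia.
rewrite count_pred0 addn0 => ->; rewrite !count_uniq_mem ?iota_uniq //.
by rewrite !mem_iota; lia.
Qed.

Section LinearlyRecurrentSequence.
Variables (K : nat) (A : finType) (x : fullshift A).
Hypothesis lrx : lr_sequence K x.

Lemma lr_next (i : int) (m : nat) : (0 < m)%N ->
  exists2 j, i < j <= i + (K * m)%N%:Z & agree x j x i m.
Proof.
move=> m0.
have langu : language x (word_at x i m).
  by exists i; apply/occurs_word_at.
have [M /(_ i)] := lrx.1 _ langu.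
move=> [|[j hj /occurs_word_at xj] _]; first exact/occurs_word_at.
have ex : exists d, `[< (0 < d)%N /\ agree x (i + d%:Z) x i m >].
  exists `|j - i|%N; apply/asboolP; split; first lia.
  by rewrite (_ : i + _ = j) //; lia.
case: (ex_minnP ex) => d /asboolP[d0 hd] dmin.
have hmin : forall j, (0 < j < d)%N -> ~ agree x (i + j%:Z) x i m.
  move=> k /andP[k0 kd] xk.
  by have := dmin k; rewrite asboolE => /(_ (conj k0 xk)); lia.
have nilu : word_at x i m != [::] by rewrite -size_eq0 size_mkseq; lia.
have := lrx.2 _ _ nilu langu (return_word_word_at m0 d0 hd hmin).
by rewrite !size_mkseq => dK; exists (i + d%:Z) => //; lia.
Qed.

Lemma lr_prev (i : int) (m : nat) : exists2 j, j < i & agree x j x i m.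
Proof.
have langu : language x (word_at x i m).
  by exists i; apply/occurs_word_at.
have [M /(_ i)] := lrx.1 _ langu.
move=> [|_ [j hj /occurs_word_at xj]]; first exact/occurs_word_at.
by exists j => //; lia.
Qed.

(** Walk left from [i] through earlier occurrences until below [p], then right by steps of at most
    [K * m]: the first occurrence not below [p] is the required one. *)
Lemma lr_window (p i : int) (m : nat) : (0 < m)%N ->
  exists2 s, 0 <= s <= (K * m)%N%:Z & agree x (p + s) x i m.
Proof.
move=> m0.
have [j jp xj] : exists2 j, j < p & agree x j x i m.
  have [d] := ubnP `|i - p|%N.
  elim: d i => // d IH i hd; have [ip|pi] := ltP i p; first by exists i.
  have [j ji xj] := lr_prev i m; have [jp|pj] := ltP j p; first by exists j.
  have [|k kp xk] := IH j; first lia.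
  by exists k => //; exact: agree_trans xj.
have [d] := ubnP `|p - j|%N.
elim: d j jp xj => // d IH j jp xj hd.
have [k hk xk] := lr_next j m0.
have xki := agree_trans xk xj.
have [kp|pk] := ltP k p; first by apply: (IH k) => //; lia.
exists (k - p); first lia.
by rewrite (_ : p + _ = k) //; lia.
Qed.

End LinearlyRecurrentSequence.

Definition linearly_repetitive (C : int) (A : finType) (S : set (fullshift A))
    : Prop :=
  forall x y, S x -> S y -> forall p q m : int, 0 < m ->
  exists2 s, 0 <= s <= C * m & agree x (p + s) y q m.

Lemma linearly_recurrent_repetitive (X : subshift) : linearly_recurrent X ->
  exists2 C : int, 1 <= C & linearly_repetitive C X.
Proof.
move=> [K [minX [z Xz lrz]]]; exists K.+1%:Z => // x y Xx Xy p q m m0.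
pose n := `|m|%N; have mE : m = n%:Z by lia.
have [a ya] := minimal_orbit_dense (`|q| + n)%N minX Xz Xy.
have yz : agree y q z (q + a) m.
  by move=> k hk; rewrite ya ?/shiftz; [congr z|]; lia.
(* The radius is fixed before [s] is known, hence the room for every [s <= K * n]. *)
have [b xb] := minimal_orbit_dense (`|p| + K * n + n)%N minX Xz Xx.
have [|s hs zs] := lr_window lrz (p + b) (q + a) (m := n); first lia.
exists s; first by move: hs; rewrite mE; nia.
have xz : agree x (p + s) z (p + b + s) m.
  by move=> k hk; rewrite xb ?/shiftz; [congr z|]; lia.
apply: agree_trans xz _; rewrite mE; apply: agree_trans zs _.
by rewrite -mE; exact: agree_sym.
Qed.


(** * Factor maps as sliding block codes *)

Definition block_code (r : nat) (A B : finType) (S : set (fullshift A))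
    (phi : fullshift A -> fullshift B) : Prop :=
  forall x y, S x -> S y -> forall p q n : int,
  agree x (p - r%:Z) y (q - r%:Z) (n + r.*2%:Z) -> agree (phi x) p (phi y) q n.

Lemma block_code_leq r s (A B : finType) (S : set (fullshift A))
    (phi : fullshift A -> fullshift B) :
  (r <= s)%N -> block_code r S phi -> block_code s S phi.
Proof.
move=> rs code x y Sx Sy p q n xy; apply: code => //.
by apply: agree_sub xy _ _ _; lia.
Qed.

Lemma block_code_agree_upto r (A B : finType) (S : set (fullshift A))
    (phi : fullshift A -> fullshift B) x y M :
  block_code r S phi -> S x -> S y ->
  agree_upto (M + r) x y -> agree_upto M (phi x) (phi y).
Proof.
move=> code Sx Sy xy k hk.
apply: (agree_at (p := k) (q := k) (n := 1)); [|lia|lia].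
by apply: code => // l hl; apply: xy; lia.
Qed.

Section Factor.
Variables (X Y : subshift).
Variable phi : fullshift (alphabet X) -> fullshift (alphabet Y).
Hypothesis phiF : @factor_map X Y phi.

Lemma factor_in x : points X x -> points Y (phi x).
Proof. by case: phiF => _ <- _ Xx; exists x. Qed.

Lemma factor_onto y : points Y y -> exists2 x, points X x & phi x = y.
Proof. by case: phiF => _ <- _ [x Xx <-]; exists x. Qed.

Lemma factor_shiftz a x : points X x -> phi (shiftz a x) = shiftz a (phi x).
Proof.
have [_ _ comm] := phiF.
have shiftn (n : nat) y : points X y ->
    phi (shiftz n%:Z y) = shiftz n%:Z (phi y).
  move=> Xy; elim: n => [|n IH]; first by rewrite !shiftz0.
  rewrite (_ : Posz n.+1 = 1 + n%:Z) -?shiftzD; last lia.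
  by rewrite -shift_shiftz comm ?IH //; exact: subshift_shiftz.
move=> Xx; case: (leP 0 a) => a0.
  by rewrite (_ : a = `|a|%N%:Z) ?shiftn //; lia.
have Xy := subshift_shiftz a Xx.
rewrite -{2}[x]shiftz0 (_ : 0 = `|a|%N%:Z + a) -?shiftzD ?shiftn; [|by []|lia].
by rewrite shiftzD (_ : a + _ = 0) ?shiftz0 //; lia.
Qed.

(** The Curtis-Hedlund-Lyndon theorem. Commutation with the shift reduces it to coordinate [0];
    without a radius there, ever closer pairs with different images would accumulate at a point of
    [X] and contradict continuity. *)
Lemma factor_block_code : exists r, block_code r X phi.
Proof.
have [cphi _ _] := phiF.
suff [r hr] : exists r, forall x y, points X x -> points X y ->
    agree_upto r x y -> phi x 0 = phi y 0.
  exists r => x y Xx Xy p q n xy k hk.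
  have := hr (shiftz (p + k) x) (shiftz (q + k) y).
  rewrite !factor_shiftz // /shiftz !add0r; apply; try exact: subshift_shiftz.
  by move=> l hl; apply: (agree_at xy); lia.
apply: contrapT => nr.
have /choice[uv huv] : forall M : nat, exists uv, [/\ points X uv.1,
    points X uv.2, agree_upto M uv.1 uv.2 & phi uv.1 0 <> phi uv.2 0].
  move=> M; apply: contrapT => h; apply: nr; exists M => x y Xx Xy xy.
  by apply: contrapT => ne; apply: h; exists (x, y).
have [x Xx hx] := seq_cluster (u := fun M => (uv M).1) (@points_closed X)
  (fun M => let: And4 h _ _ _ := huv M in h).
have /subspace_continuousP/(_ x Xx _ (nbhs_agree_upto (phi x) 0)) := cphi.
rewrite /= nbhs_simpl /= => /nbhs_sub_agree_upto[M hM].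
have [N MN xN] := hx M; have [Xu Xv uvN] := huv N; apply.
apply: etrans (esym (hM _ xN Xu 0 _)) (hM (uv N).2 _ Xv 0 _) => // k hk.
by rewrite /= xN // uvN //; lia.
Qed.

End Factor.

(** * Periodicity, and separation of occurrences in non-periodic factors *)

Lemma periodic_finite (A : finType) (S : set (fullshift A)) (d : int) :
  0 < d -> (forall x, S x -> forall t, x (t + d) = x t) -> finite_set S.
Proof.
case: d => // -[//|d] _ per.
pose g (c : {ffun 'I_d.+1 -> A}) : fullshift A :=
  fun t => c (inord `|(t %% d.+1)%Z|%N).
apply: (@sub_finite_set _ _ (g @` setT)).
  move=> x Sx; exists [ffun i : 'I_d.+1 => x (i : nat)%:Z] => //.
  apply/funext => t; rewrite /g ffunE.
  have r_ge0 : (0 <= t %% d.+1)%Z by rewrite modz_ge0.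
  have r_lt : (t %% d.+1 < d.+1)%Z by rewrite ltz_pmod.
  rewrite inordK; last lia.
  have pern n s : x (s + (d.+1 * n)%N%:Z) = x s.
    elim: n => [|n IH]; first by rewrite muln0 addr0.
    by rewrite -IH -(per x Sx (s + (d.+1 * n)%N%:Z)); congr x; lia.
  have perz q s : x (q * d.+1%:Z + s) = x s.
    case: (leP 0 q) => q0; first by rewrite -(pern `|q|%N s); congr x; nia.
    by rewrite -(pern `|q|%N (q * d.+1%:Z + s)); congr x; nia.
  by rewrite gez0_abs // [in RHS](divz_eq t d.+1) perz.
by apply: finite_image; exact: finite_finset.
Qed.

(** A linear repulsion property; the threshold [n0] absorbs the radius of the code, which spoils the
    estimate for short words. *)
Definition separated (D n0 : int) (A B : finType) (S : set (fullshift A))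
    (phi : fullshift A -> fullshift B) : Prop :=
  forall x, S x -> forall p q n : int, n0 <= n -> p <> q ->
  agree (phi x) p (phi x) q n -> n < D * `|p - q|.

Lemma separated_leq (n0 n1 D : int) (A B : finType) (S : set (fullshift A))
    (phi : fullshift A -> fullshift B) :
  n0 <= n1 -> separated D n0 S phi -> separated D n1 S phi.
Proof. by move=> n01 sep x Sx p q n n1n; apply: sep => //; lia. Qed.

(* Every word of length [q - p + 1] of [Y] occurs in a window of length
   proportional to [q - p], up to a constant depending on the radius of [phi].
   So a long enough word with period [q - p] forces all of [Y] to have it. *)
Lemma factor_separated (X Y : subshift) phi C :
  @factor_map X Y phi -> 1 <= C -> linearly_repetitive C X -> non_periodic Y ->
  exists n0 : nat, separated (2 * C) n0%:Z X phi.
Proof.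
move=> phiF C1 repX infY; have [r code] := factor_block_code phiF.
have [c cE] : exists c : nat, C = c%:Z by exists `|C|%N; lia.
(* If separation fails, [n] is at least [2 * C * (q - p)] and also exceeds [2 * c * (1 + r.*2)].
   Averaging both bounds gives [s < n] for the offset [s] found by repetitivity. *)
exists (2 * c * (1 + r.*2)).+1 => x Xx.
suff sep p q n : (2 * c * (1 + r.*2)).+1%:Z <= n -> p < q ->
    agree (phi x) p (phi x) q n -> n < 2 * C * (q - p).
  move=> p q n hn pq xpq; have [{}pq|{}pq|//] := ltgtP p q.
    by rewrite distrC gtr0_norm ?sep //; lia.
  by rewrite gtr0_norm ?sep //; [exact: agree_sym | lia].
move=> hn pq xpq; rewrite ltNge; apply/negP => short; apply: infY.
apply: (@periodic_finite _ _ (q - p)); first lia.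
move=> _ /(factor_onto phiF)[y Xy <-] t.
have [|s hs xy] := repX x y Xx Xy (p - r%:Z) (t - r%:Z) (q - p + 1 + r.*2%:Z).
  lia.
have {}xy : agree (phi x) (p + s) (phi y) t (q - p + 1).
  by apply: code => //; apply: agree_sub xy _ _ _; lia.
rewrite -(agree_at (s := q + s) (t := t + (q - p)) xy); [|lia..].
rewrite -(agree_at (s := p + s) (t := t) xy); [|lia..].
apply/esym/(agree_at xpq); last lia.
by rewrite cE in hs short; nia.
Qed.

(** * Records of coincidences between boxes, and offsets *)

Definition in_box (b : int) (i : nat) (p : int) : Prop :=
  i%:Z * b <= p < i%:Z * b + b.

(** The record of a factor. Its number of possible values depends on [N] alone, which allows a
    pigeonhole argument uniform in [b] and [n]. *)
Definition box_pairs (T : Type) (N : nat) (b n : int) (y : int -> T) :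
    {set 'I_N * 'I_N} :=
  [set B : 'I_N * 'I_N |
    `[< exists p q, [/\ in_box b B.1 p, in_box b B.2 q & agree y p y q n] >]].

Lemma in_box_ex (N : nat) (b s : int) : 0 < b -> 0 <= s < N%:Z * b ->
  exists i : 'I_N, in_box b i s.
Proof.
move=> b0 hs; have m0 : 0 <= (s %% b)%Z by rewrite modz_ge0 //; lia.
have mb : (s %% b)%Z < b by rewrite ltz_pmod.
have E := divz_eq s b.
set k := (s %/ b)%Z in E *; set l := (s %% b)%Z in E m0 mb *.
have k0 : 0 <= k by nia.
have kN : (`|k| < N)%N by nia.
by exists (Ordinal kN); rewrite /in_box /= gez0_abs // E; lia.
Qed.

Section Compare.
(* [N] boxes of side [b] cover a window of [x0] in which all words of length
   [n + 2r] of [X] occur. *)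
Variables (X : subshift) (A B : finType).
Variables (f : fullshift (alphabet X) -> fullshift A).
Variables (g : fullshift (alphabet X) -> fullshift B).
Variables (C : int) (r N : nat) (b n : int).
Hypothesis repX : linearly_repetitive C X.
Hypotheses (codef : block_code r X f) (codeg : block_code r X g).
Hypotheses (b_gt0 : 0 < b) (n_gt0 : 0 < n) (boxes : C * (n + r.*2%:Z) < N%:Z * b).
Variable x0 : fullshift (alphabet X).
Hypothesis Xx0 : points X x0.
Hypothesis sub_boxes : box_pairs N b n (f x0) \subset box_pairs N b n (g x0).

(** Copies in [x0] of windows of [x] and [y] start in boxes [i] and [j]. As [f x = f y], the pair is
    recorded for [f], hence for [g]: equal words of [g x0] start at some [p] and [q] in these boxes,
    each less than [b] away from the copies. *)
Lemma local_offset x y t : points X x -> points X y -> f x = f y ->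
  exists2 c : int, `|c| < 2 * b & agree (g x) t (g y) (t + c) (n - 4 * b).
Proof.
move=> Xx Xy fxy; have m0 : 0 < n + r.*2%:Z by lia.
(* A margin of [2 * b] on both sides absorbs the displacement of [p] and [q]. *)
set t' := t - 2 * b.
have [s hs xs] := repX Xx0 Xx (- r%:Z) (t' - r%:Z) m0.
have [s' hs' ys] := repX Xx0 Xy (- r%:Z) (t' - r%:Z) m0.
rewrite addrC in xs; rewrite addrC in ys.
have fx := codef Xx0 Xx xs; have fy := codef Xx0 Xy ys.
have gx := codeg Xx0 Xx xs; have gy := codeg Xx0 Xy ys.
have [|i hi] := @in_box_ex N b s b_gt0; first lia.
have [|j hj] := @in_box_ex N b s' b_gt0; first lia.
have : (i, j) \in box_pairs N b n (f x0).
  rewrite inE; apply/asboolP; exists s, s'; split=> //.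
  by apply: agree_trans fx _; rewrite fxy; exact: agree_sym.
move/(fintype.subsetP sub_boxes); rewrite inE => /asboolP[p [q [/= hp hq pq]]].
rewrite /in_box in hi hj hp hq; exists ((q - s') - (p - s)); first lia.
move=> k hk.
rewrite -(agree_at (s := s + (k + 2 * b)) (t := t + k) gx); [|lia..].
rewrite (agree_at (s := s + (k + 2 * b)) (t := q - p + s + (k + 2 * b)) pq); [|lia..].
by rewrite (agree_at (t := t + (q - s' - (p - s)) + k) gy) //; lia.
Qed.

Variables (D n0 : int).
Hypothesis sepg : separated D n0 X g.
Hypotheses (D_ge0 : 0 <= D) (n0_ge0 : 0 <= n0) (n0n : n0 <= n - 4 * b - 1).
Hypothesis Dn : D * (4 * b) <= n - 4 * b - 1.

(** Consecutive windows share a word of length [n - 4 * b - 1]; different offsets would place it at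
    two positions of [g y] less than [4 * b] apart, against [sepg] and [Dn]. *)
Lemma global_offset x y : points X x -> points X y -> f x = f y ->
  exists2 c : int, `|c| < 2 * b & forall k, g x k = g y (k + c).
Proof.
move=> Xx Xy fxy.
have /choice[c hc] : forall t, exists c : int,
    `|c| < 2 * b /\ agree (g x) t (g y) (t + c) (n - 4 * b).
  by move=> t; have [c] := local_offset t Xx Xy fxy; exists c.
have cS t : c (t + 1) = c t.
  apply: contrapT => ne; have [c1 g1] := hc t; have [c2 g2] := hc (t + 1).
  have : n - 4 * b - 1 < D * `|t + 1 + c t - (t + 1 + c (t + 1))|.
    apply: (sepg Xy n0n); first by move=> h; apply: ne; lia.
    apply: (@agree_trans _ (g x) (t + 1)).
      by apply: agree_sym; apply: agree_sub g1 _ _ _; lia.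
    by apply: agree_sub g2 _ _ _; lia.
  suff : D * `|t + 1 + c t - (t + 1 + c (t + 1))| <= D * (4 * b) by lia.
  by apply: ler_wpM2l => //; lia.
have cE t : c t = c 0.
  have up (k : nat) s : c (s + k%:Z) = c s.
    elim: k => [|k IH]; first by rewrite addr0.
    by rewrite -IH -(cS (s + k%:Z)); congr c; lia.
  case: (leP 0 t) => t0; first by rewrite -(up `|t|%N 0); congr c; lia.
  by rewrite -(up `|t|%N t); congr c; lia.
exists (c 0); first by have [] := hc 0.
move=> k; have [_ gk] := hc k; rewrite -(cE k).
by apply: (agree_at gk); lia.
Qed.

End Compare.

(** * Vanishing of the offset by minimality *)

Section ZeroOffset.
Variables (X Y Z : subshift).
Variables (f : fullshift (alphabet X) -> fullshift (alphabet Y)).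
Variables (g : fullshift (alphabet X) -> fullshift (alphabet Z)).
Hypotheses (minX : minimal X) (fF : @factor_map X Y f) (gF : @factor_map X Z g).
Variables (b D n0 : int).
Hypothesis sepg : separated D n0 X g.
Hypothesis offset : forall x y, points X x -> points X y -> f x = f y ->
  exists2 c : int, `|c| < b & forall k, g x k = g y (k + c).

(** The points having a partner with offset [c] form a shift-stable set containing [x]. It is
    closed: partners of approximating points accumulate at a partner of the limit, since [f] and [g]
    are block codes. *)
Lemma offset_everywhere c x y : points X x -> points X y -> f x = f y ->
  (forall k, g x k = g y (k + c)) ->
  forall z, points X z -> exists w, [/\ points X w, f z = f w &
                                    forall k, g z k = g w (k + c)].
Proof.
move=> Xx Xy fxy gxy.
pose F := [set z | points X z /\ exists w, [/\ points X w, f z = f w &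
                                    forall k, g z k = g w (k + c)]].
have Fshift a z : F z -> F (shiftz a z).
  move=> [Xz [w [Xw fzw gzw]]]; split; first exact: subshift_shiftz.
  exists (shiftz a w); split; first exact: subshift_shiftz.
    by rewrite !(factor_shiftz fF) // fzw.
  move=> k; rewrite !(factor_shiftz gF) // /shiftz gzw.
  by congr (g w); lia.
suff XF : X `<=` F by move=> z /XF[].
apply: (minimal_full minX (z := x)); [by move=> z []| |exact: Fshift..|]; last first.
  by split=> //; exists y.
move=> z hz; have Xz : points X z.
  apply: closed_mem => [|M]; first exact: points_closed.
  by have [v [Xv _] zv] := hz M; exists v.
split=> //.
have /choice[u hu] : forall M : nat, exists u, [/\ points X u.1 /\ points X u.2,
    f u.1 = f u.2, forall k, g u.1 k = g u.2 (k + c) & agree_upto M z u.1].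
  by move=> M; have [v [Xv [w [Xw h1 h2]]] zv] := hz M; exists (v, w).
have [|w Xw hw] := seq_cluster (u := fun M => (u M).2) (@points_closed X).
  by move=> M; have [[]] := hu M.
have [rf codef] := factor_block_code fF.
have [rg codeg] := factor_block_code gF.
exists w; split=> //.
  apply/funext => k; have [M MN wu] := hw (`|k| + rf)%N.
  have [[Xu Xv] fu _ zu] := hu M.
  rewrite (block_code_agree_upto codef Xw Xv wu) // -fu.
  apply: (block_code_agree_upto (M := `|k|%N) codef) => // l hl.
  by apply: zu; lia.
move=> k; have [M MN wu] := hw (`|k| + `|c| + rg)%N.
have [[Xu Xv] _ gu zu] := hu M.
rewrite (block_code_agree_upto codeg Xw Xv wu); last lia.
rewrite -gu; apply: (block_code_agree_upto (M := `|k|%N) codeg) => // l hl.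
by apply: zu; lia.
Qed.

(* By [offset_everywhere] a nonzero offset [c] could be iterated along a fibre
   of [f], which would produce arbitrarily large offsets. *)
Lemma fiber_sub x y : points X x -> points X y -> f x = f y -> g x = g y.
Proof.
move=> Xx Xy fxy; have [c _ gxy] := offset Xx Xy fxy.
suff c0 : c = 0 by apply/funext => k; rewrite gxy c0 addr0.
apply: contrapT => c0.
have iter (m : nat) : forall z, points X z ->
    exists w, [/\ points X w, f z = f w & forall k, g z k = g w (k + m%:Z * c)].
  elim: m => [|m IH] z Xz.
    by exists z; split=> // k; rewrite mul0r addr0.
  have [w [Xw fzw gzw]] := IH z Xz.
  have [v [Xv fwv gwv]] := offset_everywhere Xx Xy fxy gxy Xw.
  exists v; split=> //; first by rewrite fzw.
  by move=> k; rewrite gzw gwv; congr (g v); lia.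
(* After [|b|] iterations the offset [a] has size at least [|b|], while [offset] provides some [d]
   with [|d| < b]. *)
have [w [Xw fxw gxw]] := iter `|b|%N x Xx.
have [d hd gxw'] := offset Xx Xw fxw.
set a := `|b|%N%:Z * c in gxw.
have ad : a <> d by rewrite /a; nia.
(* The words of [g w] at [a] and [d] agree at every length, so a length reaching both bounds
   contradicts separation. *)
pose l := Num.max n0 (D * `|a - d|).
suff : l < D * `|a - d| by rewrite /l; lia.
apply: (sepg Xw _ ad); first by rewrite le_max lexx.
by move=> k _; rewrite addrC -gxw gxw' addrC.
Qed.

End ZeroOffset.

(** * From equal fibres to isomorphic images *)

Lemma same_fibers_isomorphic (X Y Z : subshift) f g x0 :
  points X x0 -> @factor_map X Y f -> @factor_map X Z g ->
  (forall x y, points X x -> points X y -> f x = f y <-> g x = g y) ->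
  isomorphic Y Z.
Proof.
move=> Xx0 fF gF fib.
have /choice[sec hsec] : forall y, exists x, points X x /\ (points Y y -> f x = y).
  move=> y; have [Yy|nYy] := pselect (points Y y); last by exists x0.
  by have [x Xx <-] := factor_onto fF Yy; exists x.
(* By [fib] the value on [Y] is independent of the section, and [psi] is injective there. *)
pose psi y := g (sec y).
have Xsec y : points X (sec y) by have [] := hsec y.
have secK y : points Y y -> f (sec y) = y by have [_] := hsec y.
have psif x : points X x -> psi (f x) = g x.
  move=> Xx; apply/fib => //; apply: secK; exact: (factor_in fF).
exists psi; first split.
- apply/subspace_continuousP => y Yy U /nbhs_sub_agree_upto[M MU].
  suff [N hN] : exists N, forall z, points Y z -> agree_upto N y z ->
      agree_upto M (psi y) (psi z).
    rewrite nbhs_filterE /=.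
    apply: filterS (nbhs_agree_upto y N) => z yz Yz.
    by apply: MU; exact: hN.
  have [rf codef] := factor_block_code fF.
  have [rg codeg] := factor_block_code gF.
  (* Continuity by compactness: lifts of bad points tending to [y] accumulate at some [x] over [y],
     where the block code of [g] gives a contradiction. *)
  apply: contrapT => nN.
  have /choice[u hu] : forall N : nat, exists u, [/\ points X u,
      agree_upto N y (f u) & ~ agree_upto M (psi y) (g u)].
    move=> N; apply: contrapT => h; apply: nN; exists N => z.
    move=> /(factor_onto fF)[u Xu <-] yu; rewrite psif //.
    by apply: contrapT => ne; apply: h; exists u.
  have [|x Xx xu] := seq_cluster (u := u) (@points_closed X).
    by move=> N; have [] := hu N.
  have fxy : f x = y.
    apply/funext => k; have [N hN xN] := xu (`|k| + rf)%N.
    have [Xu yu _] := hu N.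
    by rewrite (block_code_agree_upto codef Xx Xu xN) // yu //; lia.
  have [N hN xN] := xu (M + rg)%N; have [Xu _] := hu N; apply.
  by rewrite -fxy psif //; exact: block_code_agree_upto codeg Xx Xu xN.
- apply/seteqP; split=> [_ [y Yy <-]|z Zz]; first exact: (factor_in gF).
  have [x Xx <-] := factor_onto gF Zz.
  by exists (f x); [exact: (factor_in fF) | exact: psif].
- move=> y Yy; have [x Xx <-] := factor_onto fF Yy.
  rewrite !shift_shiftz -(factor_shiftz fF) // !psif //.
    exact: (factor_shiftz gF).
  exact: subshift_shiftz.
move=> y z /[!inE] Yy Yz.
have [x Xx <-] := factor_onto fF Yy; have [w Xw <-] := factor_onto fF Yz.
by rewrite !psif // => /fib ->.
Qed.

(** * Pigeonhole on records, and finiteness *)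

Lemma factor_pigeonhole (X : subshift) : linearly_recurrent X ->
  exists M : nat, forall Y : nat -> subshift,
  (forall i, (i < M)%N -> factor_of (Y i) X /\ non_periodic (Y i)) ->
  exists i j, [/\ (i < j)%N, (j < M)%N & isomorphic (Y j) (Y i)].
Proof.
move=> lrX; have [C C1 repX] := linearly_recurrent_repetitive lrX.
have [K [minX [x0 Xx0 _]]] := lrX.
(* [N] depends on [C] only, so the number of records is known before the factors and their radii. *)
pose N := absz (C * (8 * C + 6) + 1).
pose M := #|{set 'I_N * 'I_N}|.+1.
exists M => Y hY.
pose phi (i : 'I_M) := projT1 (cid (hY i (ltn_ord i)).1).
have phiF (i : 'I_M) : @factor_map X (Y i) (phi i) := projT2 (cid (hY i (ltn_ord i)).1).
have /choice[rn hrn] : forall i : 'I_M, exists rn : nat * nat,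
    block_code rn.1 X (phi i) /\ separated (2 * C) rn.2%:Z X (phi i).
  move=> i; have [r codei] := factor_block_code (phiF i).
  have [n0 sepi] := factor_separated (phiF i) C1 repX (hY i (ltn_ord i)).2.
  by exists (r, n0).
pose r := (\max_i (rn i).1)%N; pose n0 := (\max_i (rn i).2)%N.
have code i : block_code r X (phi i).
  apply: block_code_leq (hrn i).1.
  exact: (@leq_bigmax _ (fun i => (rn i).1)).
have sep i : separated (2 * C) n0%:Z X (phi i).
  apply: separated_leq (hrn i).2; rewrite lez_nat.
  exact: (@leq_bigmax _ (fun i => (rn i).2)).
(* [b] exceeds [n0] and [r.*2]. In [n], the part [8 * C * b] is the separation bound [D * (4 * b)]
   for [D = 2 * C], and [5 * b] covers the loss [4 * b + 1]. Then [n + r.*2] is below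
   [(8 * C + 6) * b], whence [N]. *)
pose b : int := (n0 + r.*2 + 1)%N%:Z; pose n := (8 * C + 5) * b.
have fib (i j : 'I_M) : box_pairs N b n (phi i x0) = box_pairs N b n (phi j x0) ->
    forall x y, points X x -> points X y -> phi i x = phi i y -> phi j x = phi j y.
  move=> ij; apply: (fiber_sub minX (phiF i) (phiF j) (sep j)).
  have Cb : C <= C * b by rewrite /b; nia.
  move=> x y; apply: (global_offset (N := N) (b := b) (n := n) repX (code i) (code j) _ _ _ Xx0 _ (sep j)).
  - by rewrite /b; lia.
  - by rewrite /n; nia.
  - have : C * (n + r.*2%:Z) <= C * ((8 * C + 6) * b).
      by apply: ler_wpM2l; rewrite /n /b; nia.
    have NE : N%:Z = C * (8 * C + 6) + 1 by rewrite /N gez0_abs //; nia.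
    have b0 : 0 < b by rewrite /b; lia.
    by rewrite NE [ltRHS]mulrDl mul1r -mulrA; lia.
  - by rewrite ij.
  - by lia.
  - by lia.
  - by rewrite /n; nia.
  - by rewrite /n; nia.
have [i [j [ij E]]] : exists i j : 'I_M, (i < j)%N /\
    box_pairs N b n (phi i x0) = box_pairs N b n (phi j x0).
  apply: contrapT => h.
  have /leq_card : injective (fun i : 'I_M => box_pairs N b n (phi i x0)).
    move=> i j E; case: (ltngtP i j) => [ij|ji|/val_inj//]; case: h.
      by exists i, j.
    by exists j, i.
  by rewrite card_ord ltnn.
exists i, j; split=> //.
apply: (same_fibers_isomorphic Xx0 (phiF j) (phiF i)) => x y Xx Xy.
by split; apply: fib.
Qed.

Theorem theorem1 (X : subshift) (hX : linearly_recurrent X) :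
  exists (n : nat) (Z : 'I_n -> subshift),
    forall Y : subshift, factor_of Y X -> non_periodic Y ->
    exists i : 'I_n, isomorphic Y (Z i).
Proof.
have [M pigeon] := factor_pigeonhole hX.
(* A list of maximal length will represent all factors. Isomorphisms are excluded from later to
   earlier entries, so appending [Y] asks exactly for [nisoY]. *)
pose good n (Z : nat -> subshift) :=
  (forall i, (i < n)%N -> factor_of (Z i) X /\ non_periodic (Z i)) /\
  forall i j, (i < j)%N -> (j < n)%N -> ~ isomorphic (Z j) (Z i).
have ex : exists n, `[< exists Z, good n Z >].
  by exists 0%N; apply/asboolP; exists (fun=> X); split.
have bounded n : `[< exists Z, good n Z >] -> (n <= M)%N.
  move=> /asboolP[Z [fZ nisoZ]]; rewrite leqNgt; apply/negP => Mn.
  have [|i [j [ij jM iso]]] := pigeon Z; first by move=> i iM; apply: fZ; lia.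
  by apply: nisoZ iso => //; lia.
case: (ex_maxnP ex bounded) => n /asboolP[Z [fZ nisoZ]] nmax.
exists n, (fun i => Z i) => Y fY npY; apply: contrapT => nisoY.
have : (n.+1 <= n)%N; last by rewrite ltnn.
apply: nmax; apply/asboolP; exists (fun k => if (k < n)%N then Z k else Y).
split=> [i _|i j ij jn]; first by case: ifP => // /fZ.
rewrite (_ : (i < n)%N = true); last lia.
case: ifP => [jn'|_]; first exact: nisoZ.
have iltn : (i < n)%N by lia.
by move=> iso; apply: nisoY; exists (Ordinal iltn).
Qed.
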